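(* Let $\mathcal{F}=\{A_1,A_2,\ldots,A_m\}\subset\mathbb{C}^{n\times n}$ be irreducible, with $A_j$ being of rank one for $2\le j\le m$ (and no rank condition on $A_1$). Then $$\rho(\mathcal{F})=\max\Big\{\rho^*,\ \max_{1\le i\le m}\rho(A_i)\Big\},$$ where $$\rho^*=\max_{n_j\ge 0,\ 0<\ell\le m}\ \rho\big(A_1^{n_1}A_{i_1}A_1^{n_2}A_{i_2}\cdots A_1^{n_\ell}A_{i_\ell}\big)^{\frac{1}{n_1+\cdots+n_\ell+\ell}},$$ the maximum being taken over all integers $\ell$ with $0<\ell\le m$, all integers $n_1,\ldots,n_\ell\ge 0$, and all indices $i_1,\ldots,i_\ell$ with $2\le i_j\le m$ and $i_s\neq i_t$ when $s\neq t$.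
   Context: For a finite set $\mathcal{F}=\{A_1,\ldots,A_m\}$ of complex $n\times n$ matrices and $k\ge 1$, let $\mathcal{F}_k=\{A_{i_1}A_{i_2}\cdots A_{i_k}: 1\le i_j\le m,\ j=1,\ldots,k\}$ be the set of all products of length $k$. The joint (equivalently, generalized) spectral radius of $\mathcal{F}$ is $\rho(\mathcal{F})=\lim_{k\to\infty}\max_{A\in\mathcal{F}_k}\|A\|^{1/k}=\limsup_{k\to\infty}\max_{A\in\mathcal{F}_k}\rho(A)^{1/k}$, where $\|\cdot\|$ is any sub-multiplicative matrix norm and $\rho(A)$ is the spectral radius of a matrix $A$ (the two expressions are known to coincide for finite sets). The family $\mathcal{F}$ is irreducible if the matrices in $\mathcal{F}$ have no common non-trivial invariant linear subspace of $\mathbb{C}^n$ (i.e. none other than $\{0\}$ and $\mathbb{C}^n$).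
   Formalization: The maximum defining ρ* need not be attained (e.g. A_1=diag(1,1/2), A_2=J/10, J all ones), so ρ* is taken as a supremum (0 if m=1); it is also shown that ρ(F) itself equals one of the listed product values or some ρ(A_i). *)

(* Defs.v *)
From HB Require Import structures.
From mathcomp Require Import all_boot all_order all_algebra.
From mathcomp Require Import all_classical all_reals all_analysis.
From mathcomp Require Import complex.

Set Implicit Arguments.
Unset Strict Implicit.
Unset Printing Implicit Defensive.

Import Order.TTheory GRing.Theory Num.Theory.
Import numFieldNormedType.Exports.

Local Open Scope classical_set_scope.
Local Open Scope ring_scope.

(* The norm `|z| of z : R[i] lives in R[i]; this is its value in R. *)
Notation modulus := ComplexField.Normc.normc.

(* The set is finite, and nonempty when 0 < n, so the supremum is a maximum. *)
Definition spectral_radius (R : realType) (n : nat) (M : 'M[R[i]]_n) : R :=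
  sup [set modulus a | a in [set a : R[i] | eigenvalue M a]].

Record submultiplicative_norm (R : realType) (n : nat)
    (N : 'M[R[i]]_n -> R) : Prop := SubmultiplicativeNorm {
  norm_ge0 : forall M, 0 <= N M;
  norm_eq0 : forall M, N M = 0 -> M = 0;
  norm_scale : forall a M, N (a *: M) = modulus a * N M;
  norm_triangle : forall M1 M2, N (M1 + M2) <= N M1 + N M2;
  norm_submul : forall M1 M2, N (M1 *m M2) <= N M1 * N M2 }.

(* All terms are nonnegative, so the maxima based at 0 here and below are
   genuine maxima.  The limit exists by Fekete's lemma when N is a
   submultiplicative norm and 0 < m; the term of index k = 0 is irrelevant. *)
Definition joint_spectral_radius (R : realType) (n m : nat)
    (N : 'M[R[i]]_n -> R) (A : 'I_m -> 'M[R[i]]_n) : R :=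
  lim ((fun k : nat =>
    \big[Num.max/0]_(w : k.-tuple 'I_m)
      N (\prod_(i <- w) A i) `^ (k%:R^-1)) @ \oo).

Definition irreducible_family (R : realType) (n m : nat)
    (A : 'I_m -> 'M[R[i]]_n) : Prop :=
  forall U : {vspace 'cV[R[i]]_n},
    (forall i v, v \in U -> A i *m v \in U) ->
    U = 0%VS \/ U = fullv.

(* The family A_1, ..., A_m is indexed by 'I_m.+1 (with m shifted by one), and
   the distinguished matrix A_1 is A ord0. *)
Definition cycle_values (R : realType) (n m : nat)
    (A : 'I_m.+1 -> 'M[R[i]]_n) : set R :=
  [set x | exists (l : nat) (p : 'I_l -> nat) (s : 'I_l -> 'I_m.+1),
    [/\ (0 < l <= m.+1)%N,
        forall j, s j != ord0,
        injective s &
        x = spectral_radius (\prod_(j < l) (A ord0 ^+ p j * A (s j)))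
              `^ ((\sum_(j < l) p j + l)%N%:R^-1)]].

(* A supremum: the exponents are unbounded and the value need not be attained,
   e.g. A_1 = diag(1, 1/2) and A_2 = (1/10) J with J the all-ones 2 x 2 matrix.
   The set is empty when there is no A_j with j >= 2; its sup is then 0. *)
Definition rho_star (R : realType) (n m : nat)
    (A : 'I_m.+1 -> 'M[R[i]]_n) : R :=
  sup (cycle_values A).

(* Main.v *)
Require Import Defs.
From HB Require Import structures.
From mathcomp Require Import all_boot all_order all_algebra.
From mathcomp Require Import all_classical all_reals all_analysis.
From mathcomp Require Import complex.
From mathcomp Require Import zify ring lra.

Set Implicit Arguments.
Unset Strict Implicit.
Unset Printing Implicit Defensive.

Import Order.TTheory GRing.Theory Num.Theory.
Import numFieldNormedType.Exports.

Local Open Scope classical_set_scope.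
Local Open Scope ring_scope.

(* If M has rank one then M Y M = c M with |c| = rho(M Y).  Hence a word in which
   a rank-one letter occurs twice splits off a closed word, both for the norm and,
   after cyclic rotation, for the spectral radius; repeating this leaves only
   words whose rank-one letters are distinct, and up to rotation these are the
   words defining rho^*.  So once s exceeds rho(A_1) and bounds all cycle values,
   every word of length k has norm O(s^k), the powers of A_1 being controlled by
   Cayley-Hamilton.  Conversely, cutting the k-th power of a word of length L into
   L words of length k gives rho(word)^(1/L) <= max_{F_k} ||.||^(1/k) for every k,
   so the limit is squeezed. *)

(** * Spectral radii: norm bounds, cyclic invariance, products with a rank-one factor *)

Section SpectralRadius.

Variables (R : realType) (n : nat).
Implicit Types (a : R[i]) (M X Y : 'M[R[i]]_n).

Lemma modulus_ge0 a : 0 <= modulus a.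
Proof. by case: a => x y; rewrite /= sqrtr_ge0. Qed.

Lemma spectral_radius_ge0 M : 0 <= spectral_radius M.
Proof.
rewrite /spectral_radius; set S := (X in sup X).
have [hS|hS] := pselect (has_sup S); last by rewrite sup_out.
have [_ [a Ma _]] := hS.1.
by apply: le_trans (modulus_ge0 a) _; apply: sup_upper_bound => //; exists a.
Qed.

(** The eigenvalue 0 has modulus 0, so only nonzero eigenvalues need checking; later this keeps
    transported eigenvectors nonzero. *)
Lemma spectral_radius_le M (b : R) : 0 <= b ->
  (forall a, a != 0 -> eigenvalue M a -> modulus a <= b) ->
  spectral_radius M <= b.
Proof.
move=> b0 Mb; rewrite /spectral_radius; set S := (X in sup X).
have [->|/set0P S0] := eqVneq S set0; first by rewrite sup0.
apply: ge_sup => // _ [a Ma <-].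
have [->|a0] := eqVneq a 0; last exact: Mb.
by rewrite ComplexField.Normc.normc0.
Qed.

Variables (N : 'M[R[i]]_n -> R) (hN : submultiplicative_norm N).

Lemma eigenvalue_le_norm M a : eigenvalue M a -> modulus a <= N M.
Proof.
move=> /eigenvalueP[v vM v0].
(* [N] measures square matrices only, so the left eigenvector is repeated as every row of [V]. *)
pose V : 'M[R[i]]_n := \matrix_(i, j) v 0 j.
have VM : V *m M = a *: V.
  apply/row_matrixP => i; rewrite row_mul linearZ/=.
  suff -> : row i V = v by [].
  by apply/rowP => j; rewrite !mxE.
have NV : N V != 0.
  apply/eqP => /(norm_eq0 hN) V0; move/eqP: v0; apply.
  apply/rowP => j; have := congr1 (fun B : 'M[R[i]]_n => B j j) V0.
  by rewrite !mxE.
rewrite -(@ler_pM2r _ (N V)); last by rewrite lt0r NV (norm_ge0 hN).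
by rewrite -(norm_scale hN) -VM mulrC (norm_submul hN).
Qed.

Lemma spectral_radius_le_norm M : spectral_radius M <= N M.
Proof.
apply: spectral_radius_le; first exact: norm_ge0 hN _.
by move=> a _; exact: eigenvalue_le_norm.
Qed.

Lemma eigenvalue_le_spectral_radius M a :
  eigenvalue M a -> modulus a <= spectral_radius M.
Proof.
move=> Ma; apply: ub_le_sup; last by exists a.
by exists (N M) => _ [b Mb <-]; exact: eigenvalue_le_norm.
Qed.

(** If [v] is a left eigenvector of [X *m Y] for [a != 0], then [v *m X] is one of [Y *m X], nonzero
    because [a] is. *)
Lemma spectral_radiusM_comm_le X Y :
  spectral_radius (X *m Y) <= spectral_radius (Y *m X).
Proof.
apply: spectral_radius_le; first exact: spectral_radius_ge0.
move=> a a0 /eigenvalueP[v vXY v0]; apply: eigenvalue_le_spectral_radius.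
apply/eigenvalueP; exists (v *m X).
  by rewrite scalemxAl -vXY !mulmxA.
apply: contra_neq v0 => vX.
move: vXY; rewrite mulmxA vX mul0mx => /esym/eqP.
by rewrite scaler_eq0 (negPf a0) => /eqP.
Qed.

Lemma spectral_radiusM_comm X Y :
  spectral_radius (X *m Y) = spectral_radius (Y *m X).
Proof. by apply: le_anti; apply/andP; split; exact: spectral_radiusM_comm_le. Qed.

Lemma spectral_radiusZ_le a M :
  spectral_radius (a *: M) <= modulus a * spectral_radius M.
Proof.
apply: spectral_radius_le; first by rewrite mulr_ge0 ?modulus_ge0 ?spectral_radius_ge0.
move=> b b0 /eigenvalueP[v vM v0].
have a0 : a != 0.
  apply: contra_neq b0 => a0; move: vM; rewrite a0 scale0r mulmx0.
  by move=> /esym/eqP; rewrite scaler_eq0 (negPf v0) orbF => /eqP.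
rewrite -(divfK a0 b) [b / a * a]mulrC ComplexField.Normc.normcM.
rewrite ler_wpM2l ?modulus_ge0 //.
apply: eigenvalue_le_spectral_radius; apply/eigenvalueP; exists v => //.
by rewrite [b / a]mulrC -scalerA -vM -scalemxAr scalerA mulVf ?scale1r.
Qed.

Lemma eigenvalueX M a k : eigenvalue M a -> eigenvalue (M ^+ k) (a ^+ k).
Proof.
move=> /eigenvalueP[v vM v0]; apply/eigenvalueP; exists v => //.
elim: k => [|k IHk]; first by rewrite !expr0 mulmx1 scale1r.
by rewrite !exprSr -mulmxE mulmxA IHk -scalemxAl vM scalerA.
Qed.

(** Factor [M] as a column [u] times a row [v]: then [c] is the scalar [v *m Y *m u], which is also
    the only possible nonzero eigenvalue of [M *m Y]. *)
Lemma rank1_sandwich M Y : \rank M = 1%N ->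
  exists2 c, M *m Y *m M = c *: M & spectral_radius (M *m Y) = modulus c.
Proof.
move=> rM; have := mulmx_base M.
move: (col_base M) (row_base M); rewrite rM => u v uv.
pose c := (v *m Y *m u) 0 0.
have cE : v *m Y *m u = c%:M by rewrite [LHS]mx11_scalar.
have E : M *m Y *m M = c *: M.
  rewrite -uv -!mulmxA (mulmxA v Y) (mulmxA (v *m Y) u) cE mul_scalar_mx.
  by rewrite -scalemxAr.
exists c => //; apply/eqP; rewrite eq_le; apply/andP; split.
  apply: spectral_radius_le; first exact: modulus_ge0.
  move=> a a0 /eigenvalueP[x xMY x0].
  suff -> : a = c by [].
  (* The product [x *m M *m Y *m M] equals both [a *: (x *m M)] and [c *: (x *m M)]. *)
  have : (a - c) *: (x *m M) = 0.
    by rewrite scalerBl !scalemxAl -xMY -!mulmxA -scalemxAl scalemxAr -E !mulmxA subrr.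
  move/eqP; rewrite scaler_eq0 subr_eq0 => /orP[/eqP//|/eqP xM].
  move: xMY; rewrite mulmxA xM mul0mx => /esym/eqP.
  by rewrite scaler_eq0 (negPf a0) (negPf x0).
have [->|c0] := eqVneq c 0.
  by rewrite ComplexField.Normc.normc0 spectral_radius_ge0.
apply: eigenvalue_le_spectral_radius; apply/eigenvalueP; exists (v *m Y).
  by rewrite -uv !mulmxA cE mul_scalar_mx scalemxAl.
apply: contra_neq c0 => vY; move: cE; rewrite vY mul0mx => /matrixP/(_ 0 0).
by rewrite !mxE.
Qed.

End SpectralRadius.

(** * Geometric bounds on the powers of a single matrix *)

Section PowerBound.

Variables (R : realType) (n : nat) (N : 'M[R[i]]_n.+1 -> R).
Hypothesis hN : submultiplicative_norm N.
Implicit Types (M B : 'M[R[i]]_n.+1) (s : R).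

Lemma norm0 : N 0 = 0.
Proof. by rewrite -(scale0r 0) (norm_scale hN) ComplexField.Normc.normc0 mul0r. Qed.

(** Induction on [zs], with [B] general so that it can absorb the factor [M - z%:M]. Then
    [B * M ^+ k] satisfies a first-order recursion with multiplier [z] and a forcing term bounded by
    [D * s ^+ k], where [modulus z < s]. *)
Lemma annihilated_power_bound M s (zs : seq R[i]) B : 0 < s ->
    (forall z, z \in zs -> modulus z < s) ->
    B * \prod_(z <- zs) (M - z%:M) = 0 ->
  exists2 D : R, 0 <= D & forall k, N (B * M ^+ k) <= D * s ^+ k.
Proof.
move=> s0; elim: zs B => [|z zs IH] B zs_s.
  rewrite big_nil mulr1 => ->; exists 0 => // k.
  by rewrite mul0r norm0 mul0r.
rewrite big_cons mulrA => /IH[z' z'zs|D D0 BD].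
  by apply: zs_s; rewrite in_cons z'zs orbT.
have zs0 : 0 < s - modulus z by rewrite subr_gt0 zs_s ?mem_head.
(* [N B] covers [k = 0]; the second term ensures [modulus z * E + D <= s * E] for this constant
   [E]. *)
exists (N B + D / (s - modulus z)).
  by rewrite addr_ge0 ?(norm_ge0 hN) ?divr_ge0 // ltW.
elim=> [|k IHk].
  by rewrite expr0 !mulr1 lerDl divr_ge0 // ltW.
have -> : B * M ^+ k.+1 = z *: (B * M ^+ k) + B * (M - z%:M) * M ^+ k.
  rewrite mulrBr mulrBl exprS mulrA addrC.
  by rewrite -[B * z%:M]/(B *m z%:M) mul_mx_scalar -scalerAl subrK.
apply: le_trans (norm_triangle hN _ _) _; rewrite (norm_scale hN).
apply: le_trans (lerD (ler_wpM2l (modulus_ge0 _) IHk) (BD k)) _.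
rewrite mulrA -mulrDl exprS mulrA ler_wpM2r ?exprn_ge0 ?(ltW s0) //.
rewrite -lerBrDl [_ * s]mulrC -mulrBl mulrDr.
by rewrite [_ * (D / _)]mulrC divfK ?gt_eqF // lerDr mulr_ge0 ?(norm_ge0 hN) // ltW.
Qed.

Lemma power_bound M s : spectral_radius M < s ->
  exists2 D : R, 0 <= D & forall k, N (M ^+ k) <= D * s ^+ k.
Proof.
move=> Ms; have s0 : 0 < s by apply: le_lt_trans Ms; exact: spectral_radius_ge0.
have [zs zsE] := closed_field_poly_normal (char_poly M).
rewrite (monicP (char_poly_monic M)) scale1r in zsE.
have [z||D D0 MD] := @annihilated_power_bound M s zs 1 s0.
- rewrite -root_prod_XsubC -zsE -eigenvalue_root_char => Mz.
  by apply: le_lt_trans Ms; exact: eigenvalue_le_spectral_radius hN _ _ Mz.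
- rewrite mul1r -[RHS](Cayley_Hamilton M) zsE rmorph_prod.
  by apply: eq_bigr => z _; rewrite rmorphB /= horner_mx_X horner_mx_C.
by exists D => // k; rewrite -[M ^+ k]mul1r.
Qed.

End PowerBound.

(** * Real inequalities that absorb a constant factor and clear roots *)

Lemma eventually_geometric_le (R : realType) (C s t : R) : 0 < s -> s < t ->
  exists K, forall k, (K <= k)%N -> C * s ^+ k <= t ^+ k.
Proof.
move=> s0 st; have t0 := lt_trans s0 st.
have st1 : `|s / t| < 1.
  by rewrite gtr0_norm ?divr_gt0 // ltr_pdivrMr // mul1r.
have /cvgrPdist_le/(_ 1 ltr01)[K _ HK] := cvg_geometric C st1.
exists K => k /HK /=; rewrite sub0r normrN => /ler_normlW.
rewrite /geometric/= expr_div_n mulrA ler_pdivrMr ?exprn_gt0 // mul1r //.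
Qed.

Lemma root_le (R : realType) (x b : R) (k : nat) : 0 <= x -> 0 <= b -> (0 < k)%N ->
  (x `^ k%:R^-1 <= b) = (x <= b ^+ k).
Proof.
move=> x0 b0 k0; have kR : k%:R != 0 :> R by rewrite pnatr_eq0 -lt0n.
rewrite -(@ler_pXn2r _ k) ?nnegrE ?powR_ge0 //.
by rewrite -[leLHS]powR_mulrn ?powR_ge0 // -powRrM mulVf // powRr1.
Qed.

(** * Words in the family and their correspondence with cycle values *)

Section Words.

Variables (R : realType) (n m : nat) (A : 'I_m.+1 -> 'M[R[i]]_n.+1).
Implicit Types (w : seq 'I_m.+1) (j : 'I_m.+1) (s x : R).

Definition word_prod w : 'M[R[i]]_n.+1 := \prod_(i <- w) A i.

Definition rank1_letters w := [seq j <- w | j != ord0].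

Lemma word_prod_cat w1 w2 : word_prod (w1 ++ w2) = word_prod w1 * word_prod w2.
Proof. exact: big_cat. Qed.

Lemma word_prod_cons j w : word_prod (j :: w) = A j * word_prod w.
Proof. exact: big_cons. Qed.

Lemma word_block_decomposition w : exists (ps : seq (nat * 'I_m.+1)) (z : nat),
  [/\ word_prod w = \prod_(p <- ps) (A ord0 ^+ p.1 * A p.2) * A ord0 ^+ z,
      rank1_letters w = unzip2 ps &
      size w = (\sum_(p <- ps) p.1 + size ps + z)%N].
Proof.
elim: w => [|j w [ps [z [wE nzE szE]]]].
  by exists [::], 0%N; rewrite /word_prod !big_nil expr0 mulr1.
rewrite word_prod_cons wE /= szE nzE; have [->|j0] := eqVneq j ord0; last first.
  exists ((0%N, j) :: ps), z.
  by rewrite !big_cons expr0 mul1r mulrA add0n addnS.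
case: ps => [|[p i] ps] in wE nzE szE *; last first.
  exists ((p.+1, i) :: ps), z; rewrite !big_cons exprS !mulrA.
  by split=> //=; rewrite !addSn.
by exists [::], z.+1; rewrite !big_nil !mul1r exprS /= addnS.
Qed.

Lemma non_uniq_split w : ~~ uniq (rank1_letters w) ->
  exists a b c j, j != ord0 /\ w = a ++ j :: b ++ j :: c.
Proof.
elim: w => [//|j w IH].
have [jw nzw|] := boolP ((j != ord0) && (j \in w)).
  case/andP: jw => j0 /splitPr[b c]; by exists [::], b, c, j.
rewrite negb_and negbK /= => j0w nzw.
have /IH[a [b [c [i [i0 ->]]]]] : ~~ uniq (rank1_letters w).
  case: eqP j0w nzw => //= _ jw.
  by rewrite mem_filter (negPf jw) andbF.
by exists (j :: a), b, c, i.
Qed.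

Lemma spectral_radius_word_prodC (N : 'M[R[i]]_n.+1 -> R)
    (hN : submultiplicative_norm N) w1 w2 :
  spectral_radius (word_prod (w1 ++ w2)) = spectral_radius (word_prod (w2 ++ w1)).
Proof. by rewrite !word_prod_cat; exact: spectral_radiusM_comm hN _ _. Qed.

(** A word may end in copies of [A ord0], whereas a cycle ends in a rank-one letter; rotating those
    copies to the front preserves the spectral radius and the length. *)
Lemma cycle_valuesP (N : 'M[R[i]]_n.+1 -> R) (hN : submultiplicative_norm N) x :
  cycle_values A x <->
  exists w, [/\ (0 < size (rank1_letters w))%N, uniq (rank1_letters w) &
    x = spectral_radius (word_prod w) `^ (size w)%:R^-1].
Proof.
split=> [[l [p [s [/andP[l0 _] s0 s_inj ->]]]]|[w [w0 w_uniq ->]]].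
  pose w := flatten [seq rcons (nseq (p k) ord0) (s k) | k <- enum 'I_l].
  have nzE : rank1_letters w = map s (enum 'I_l).
    rewrite /rank1_letters filter_flatten -map_comp -(flatten_map1 s); congr flatten.
    by apply: eq_map => k /=; rewrite filter_rcons s0 filter_nseq eqxx.
  have wE : word_prod w = \prod_(k < l) (A ord0 ^+ p k * A (s k)).
    rewrite /word_prod big_flatten big_map enumT.
    rewrite -[Finite.enum _](locked_withE index_enum_key).
    by apply: eq_bigr => k _; rewrite big_rcons big_nseq iter_mulr_1.
  have szE : size w = (\sum_(k < l) p k + l)%N.
    rewrite size_flatten /shape -map_comp sumnE big_map big_enum /=.
    under eq_bigr do rewrite size_rcons size_nseq -addn1.
    by rewrite big_split sum1_card card_ord.
  exists w; rewrite wE szE nzE size_map size_enum_ord (map_inj_uniq s_inj).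
  by split; rewrite ?enum_uniq.
have [ps [z [wE nzE szE]]] := word_block_decomposition w.
move: w0 w_uniq; rewrite nzE.
have : all (fun j => j != ord0) (unzip2 ps) by rewrite -nzE; exact: filter_all.
case: ps => // -[p i] ps in wE nzE szE * => ps0 _ ps_uniq.
set q0 := (p, i) in wE nzE szE ps0 ps_uniq *.
(* After rotation the [z] trailing copies of [A ord0] join the first block. *)
pose qs := ((z + p)%N, i) :: ps.
have qs2 : unzip2 qs = unzip2 (q0 :: ps) by [].
exists (size qs), (fun k => (nth q0 qs k).1), (fun k => (nth q0 qs k).2); split.
- rewrite /= -[size ps](size_map snd) -[X in (X < _)%N]/(size (unzip2 ps)).
  rewrite -[(size _).+1]/(size (unzip2 (q0 :: ps))) -(card_uniqP ps_uniq).
  by rewrite -[leqRHS]card_ord max_card.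
- by move=> k; apply: (allP ps0); rewrite -qs2; apply: map_f; exact: mem_nth.
- move=> k1 k2; rewrite -!(nth_map q0 i snd) // => /eqP.
  by rewrite nth_uniq ?size_map // => /eqP/val_inj.
have -> : (\sum_(k < size qs) (nth q0 qs k).1 + size qs)%N = size w.
  rewrite szE -(big_mkord xpredT (fun k => (nth q0 qs k).1)).
  by rewrite -(big_nth q0 xpredT (fun q => q.1)) !big_cons /=; lia.
have -> : \prod_(k < size qs) (A ord0 ^+ (nth q0 qs k).1 * A (nth q0 qs k).2) =
    A ord0 ^+ z * \prod_(q <- q0 :: ps) (A ord0 ^+ q.1 * A q.2).
  rewrite -(big_mkord xpredT (fun k => A ord0 ^+ (nth q0 qs k).1 * A (nth q0 qs k).2)).
  rewrite -(big_nth q0 xpredT (fun q => A ord0 ^+ q.1 * A q.2)) !big_cons /=.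
  by rewrite exprD !mulrA.
rewrite wE; have := spectral_radiusM_comm hN
  (\prod_(q <- q0 :: ps) (A ord0 ^+ q.1 * A q.2)) (A ord0 ^+ z).
by rewrite !mulmxE => ->.
Qed.

End Words.

(** * Growth of word products, by cutting at repeated rank-one letters *)

Section Bounds.

Variables (R : realType) (n m : nat) (N : 'M[R[i]]_n.+1 -> R).
Variables (hN : submultiplicative_norm N) (A : 'I_m.+1 -> 'M[R[i]]_n.+1).
Hypothesis hrank : forall j : 'I_m.+1, j != ord0 -> \rank (A j) = 1%N.
Implicit Types (w : seq 'I_m.+1) (s B : R).

(** Strong induction on length. Once a word is rotated to the form [j b j c a], the sandwich
    identity turns its product into [z] times that of [j c a], with [modulus z] the spectral radius
    of [j b]. Both words are shorter and keep the rank-one letter [j]. *)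
Lemma cycle_bound_word w s : 0 < s -> (forall x, cycle_values A x -> x <= s) ->
  (0 < size (rank1_letters w))%N ->
  spectral_radius (word_prod A w) <= s ^+ size w.
Proof.
move=> s0 cycle_s; have [k] := ubnP (size w); elim: k w => // k IH w wk w0.
have [w_uniq|/non_uniq_split] := boolP (uniq (rank1_letters w)).
  rewrite -root_le ?spectral_radius_ge0 ?(ltW s0) //.
    by apply: cycle_s; apply/(cycle_valuesP _ hN); exists w.
  by apply: leq_trans w0 _; rewrite size_filter count_size.
move=> [a [b [c [j [j0 wE]]]]].
have jb0 d : (0 < size (rank1_letters (j :: d)))%N by rewrite /= j0.
rewrite wE (spectral_radius_word_prodC A hN) /= word_prod_cons -catA word_prod_cat.
rewrite /= word_prod_cons.
have [z zE zr] := rank1_sandwich hN (word_prod A b) (hrank j0).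
have -> : A j * (word_prod A b * (A j * word_prod A (c ++ a))) =
    z *: word_prod A (j :: c ++ a).
  by rewrite word_prod_cons scalerAl -zE !mulrA.
apply: le_trans (spectral_radiusZ_le hN _ _) _.
have szE : size w = (size (j :: b) + size (j :: c ++ a))%N.
  by rewrite wE /= !size_cat /= size_cat /=; lia.
rewrite -wE szE exprD ler_pM ?modulus_ge0 ?spectral_radius_ge0 //.
  by rewrite -zr mulmxE -word_prod_cons IH //; move: wk; rewrite szE /=; lia.
by rewrite IH //; move: wk; rewrite szE /=; lia.
Qed.

(** Distinct rank-one letters number at most [m.+1], so they separate boundedly many runs of
    [A ord0]; each letter or run costs at most a factor [E] beyond its power of [s]. *)
Lemma uniq_word_norm_bound s : spectral_radius (A ord0) < s ->
  exists2 C : R, 0 <= C & forall w, uniq (rank1_letters w) ->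
    N (word_prod A w) <= C * s ^+ size w.
Proof.
move=> A0s; have s0 : 0 < s by apply: le_lt_trans A0s; exact: spectral_radius_ge0.
have [D D0 AD] := power_bound hN A0s.
pose E := 1 + D + \sum_j N (A j) / s.
have NA0 j : 0 <= N (A j) / s by rewrite divr_ge0 ?(norm_ge0 hN) ?ltW.
have sum0 : 0 <= \sum_j N (A j) / s by apply: sumr_ge0.
have E1 : 1 <= E by rewrite /E -addrA lerDl addr_ge0.
have E0 : 0 <= E := le_trans ler01 E1.
have AE k : N (A ord0 ^+ k) <= E * s ^+ k.
  apply: le_trans (AD k) _; rewrite ler_wpM2r ?exprn_ge0 ?(ltW s0) //.
  by rewrite /E -addrA addrCA lerDl addr_ge0.
have jE j : N (A j) <= E * s.
  rewrite -ler_pdivrMr // /E (bigD1 j) //= addrCA lerDl.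
  by rewrite addr_ge0 ?addr_ge0 // sumr_ge0.
(* [k] counts the copies of [A ord0] in the current run. With [r] rank-one letters there are [r + 1]
   runs, hence the exponent [2r + 1]. *)
suff bound w k : N (A ord0 ^+ k * word_prod A w) <=
    E ^+ (size (rank1_letters w)).*2.+1 * s ^+ (k + size w).
  exists (E ^+ m.+1.*2.+1); first exact: exprn_ge0.
  move=> w w_uniq; rewrite -[word_prod A w]mul1r -(expr0 (A ord0)).
  apply: le_trans (bound w 0%N) _; rewrite ler_wpM2r ?exprn_ge0 ?(ltW s0) //.
  rewrite ler_weXn2l // ltnS leq_double -(card_uniqP w_uniq).
  by rewrite -[leqRHS]card_ord max_card.
elim: w k => [|j w IH] k; first by rewrite /word_prod big_nil mulr1 addn0.
rewrite word_prod_cons /=; have [->|j0] := eqVneq j ord0; last first.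
  rewrite -[word_prod A w]mul1r -(expr0 (A ord0)).
  apply: le_trans (norm_submul hN _ _) _.
  have -> : (k + (size w).+1 = k + (1 + (0 + size w)))%N by lia.
  rewrite doubleS !(exprD s) expr1 !exprS.
  have Njw := le_trans (norm_submul hN _ _)
    (ler_pM (norm_ge0 hN _) (norm_ge0 hN _) (jE j) (IH 0%N)).
  apply: le_trans (ler_pM (norm_ge0 hN _) (norm_ge0 hN _) (AE k) Njw) _.
  rewrite le_eqVlt; apply/orP; left; apply/eqP.
  rewrite exprS !exprD; ring.
by rewrite mulrA -exprSr; apply: le_trans (IH k.+1) _; rewrite addSnnS.
Qed.

(** A norm is not invariant under rotation, so the closed word [j b] is cut out in place. It costs
    only its spectral radius, at most [s ^+ size (j :: b)], so [C] does not grow with the number of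
    cuts. *)
Lemma word_norm_bound s : spectral_radius (A ord0) < s ->
    (forall x, cycle_values A x -> x <= s) ->
  exists2 C : R, 0 <= C & forall w, N (word_prod A w) <= C * s ^+ size w.
Proof.
move=> A0s cycle_s; have [C C0 NC] := uniq_word_norm_bound A0s; exists C => // w.
have s0 : 0 < s by apply: le_lt_trans A0s; exact: spectral_radius_ge0.
have [k] := ubnP (size w); elim: k w => // k IH w wk.
have [/NC//|/non_uniq_split] := boolP (uniq (rank1_letters w)).
move=> [a [b [c [j [j0 wE]]]]].
have [z zE zr] := rank1_sandwich hN (word_prod A b) (hrank j0).
have -> : word_prod A w = z *: word_prod A (a ++ j :: c).
  rewrite wE !word_prod_cat !word_prod_cons word_prod_cat word_prod_cons.
  by rewrite scalerAr scalerAl -zE !mulrA.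
have szE : size w = (size (j :: b) + size (a ++ j :: c))%N.
  by rewrite wE /= !size_cat /= size_cat /=; lia.
rewrite (norm_scale hN) szE exprD mulrCA ler_pM ?modulus_ge0 ?(norm_ge0 hN) //.
  by rewrite -zr mulmxE -word_prod_cons cycle_bound_word // /= j0.
by rewrite IH //; move: wk; rewrite szE /=; lia.
Qed.

Lemma modulusX (a : R[i]) k : modulus (a ^+ k) = modulus a ^+ k.
Proof.
elim: k => [|k IHk]; first by rewrite !expr0 ComplexField.Normc.normc1.
by rewrite !exprS ComplexField.Normc.normcM IHk.
Qed.

(** Counting blocks by [q.+1] avoids the case of no block, where [N 1] may exceed 1. *)
Lemma block_norm_bound k B q w : 0 <= B ->
    (forall v, size v = k -> N (word_prod A v) <= B ^+ k) ->
  size w = (q.+1 * k)%N -> N (word_prod A w) <= B ^+ size w.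
Proof.
move=> B0 NB; elim: q w => [|q IH] w szw.
  by rewrite szw mul1n; apply: NB; rewrite szw mul1n.
have kw : (k <= size w)%N by rewrite szw mulSn leq_addr.
have sz1 : size (take k w) = k by rewrite size_takel.
have sz2 : size (drop k w) = (q.+1 * k)%N by rewrite size_drop szw mulSn addKn.
rewrite -[w in word_prod A w](cat_take_drop k) word_prod_cat.
have -> : size w = (k + size (drop k w))%N by rewrite sz2 szw mulSn.
rewrite exprD; apply: le_trans (norm_submul hN _ _) _.
by rewrite ler_pM ?(norm_ge0 hN) // ?NB // IH.
Qed.

Lemma spectral_radius_le_block k B w : 0 <= B -> (0 < k)%N -> (0 < size w)%N ->
    (forall v, size v = k -> N (word_prod A v) <= B ^+ k) ->
  spectral_radius (word_prod A w) <= B ^+ size w.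
Proof.
case: k => // k B0 _ w0 NB; apply: spectral_radius_le; first exact: exprn_ge0.
move=> a _ /(eigenvalueX k.+1)/(eigenvalue_le_norm hN).
have -> : word_prod A w ^+ k.+1 = word_prod A (flatten (nseq k.+1 w)).
  by rewrite {2}/word_prod big_flatten big_nseq iter_mulr_1.
have szE : size (flatten (nseq k.+1 w)) = (size w * k.+1)%N.
  by rewrite size_flatten /shape map_nseq sumn_nseq.
move=> /le_trans/(_ (@block_norm_bound k.+1 B (size w).-1 _ B0 NB _)).
rewrite szE prednK // => /(_ erefl).
by rewrite modulusX exprM ler_pXn2r // nnegrE ?modulus_ge0 ?exprn_ge0.
Qed.

End Bounds.

(** * The limit and its attainment *)

Section JointSpectralRadius.

Variables (R : realType) (n m : nat) (N : 'M[R[i]]_n.+1 -> R).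
Variables (hN : submultiplicative_norm N) (A : 'I_m.+1 -> 'M[R[i]]_n.+1).
Hypothesis hrank : forall j : 'I_m.+1, j != ord0 -> \rank (A j) = 1%N.
Implicit Types (w : seq 'I_m.+1) (s x B : R) (k : nat).

Definition largest_norm_root k : R :=
  \big[Num.max/0]_(w : k.-tuple 'I_m.+1) N (\prod_(i <- w) A i) `^ (k%:R^-1).

Definition largest_spectral_radius : R :=
  \big[Num.max/0]_(i < m.+1) spectral_radius (A i).

Lemma largest_norm_root_ge0 k : 0 <= largest_norm_root k.
Proof. exact: bigmax_ge_id. Qed.

Lemma largest_norm_root_le k B : (0 < k)%N -> 0 <= B ->
  largest_norm_root k <= B <-> forall w, size w = k -> N (word_prod A w) <= B ^+ k.
Proof.
move=> k0 B0; split=> [/bigmax_leP[_ NB] w /eqP wk|NB].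
  by have := NB (Tuple wk) isT; rewrite root_le ?(norm_ge0 hN).
apply/bigmax_leP; split=> // w _; rewrite root_le ?(norm_ge0 hN) //.
by apply: NB; rewrite size_tuple.
Qed.

Lemma word_le_largest_norm_root k w : (0 < k)%N -> (0 < size w)%N ->
  spectral_radius (word_prod A w) `^ (size w)%:R^-1 <= largest_norm_root k.
Proof.
move=> k0 w0; rewrite root_le ?spectral_radius_ge0 ?largest_norm_root_ge0 //.
apply: (spectral_radius_le_block hN _ k0 w0); first exact: largest_norm_root_ge0.
exact/(largest_norm_root_le k0 (largest_norm_root_ge0 k)).
Qed.

Lemma cycle_le_largest_norm_root k x :
  (0 < k)%N -> cycle_values A x -> x <= largest_norm_root k.
Proof.
move=> k0 /(cycle_valuesP _ hN)[w [w0 _ ->]]; apply: word_le_largest_norm_root => //.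
by apply: leq_trans w0 _; rewrite size_filter count_size.
Qed.

Lemma cycle_le_rho_star x : cycle_values A x -> x <= rho_star A.
Proof.
(* The supremum is an upper bound only for a bounded set; the largest norm in the family,
   [largest_norm_root 1], bounds it. *)
move=> Ax; apply: ub_le_sup => //; exists (largest_norm_root 1) => y.
exact: cycle_le_largest_norm_root.
Qed.

Lemma max_le_largest_norm_root k : (0 < k)%N ->
  Num.max (rho_star A) largest_spectral_radius <= largest_norm_root k.
Proof.
move=> k0; rewrite ge_max; apply/andP; split.
  have [A0|/set0P A0] := eqVneq (cycle_values A) set0.
    by rewrite /rho_star A0 sup0 largest_norm_root_ge0.
  by apply: ge_sup => // x; exact: cycle_le_largest_norm_root.
apply/bigmax_leP; split=> [|i _]; first exact: largest_norm_root_ge0.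
have := @word_le_largest_norm_root k [:: i] k0 isT.
have -> : word_prod A [:: i] = A i by exact: big_seq1.
by rewrite root_le ?spectral_radius_ge0 ?largest_norm_root_ge0 ?expr1.
Qed.

Lemma joint_spectral_radius_rank1 :
  joint_spectral_radius N A = Num.max (rho_star A) largest_spectral_radius.
Proof.
apply: cvg_lim => //; set M := Num.max _ _.
have M0 : 0 <= M by rewrite le_max bigmax_ge_id orbT.
apply/cvgrPdist_le => e e0.
(* Half of [e] gives strict room above the spectral radius of [A ord0]; the other half absorbs [C]
   for large [k]. *)
have tM : M < M + e / 2 by rewrite ltrDl divr_gt0.
have A0M : spectral_radius (A ord0) < M + e / 2.
  by apply: le_lt_trans tM; rewrite le_max (le_bigmax _ _ ord0) orbT.
have [|C C0 NC] := word_norm_bound hN hrank A0M.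
  move=> x /cycle_le_rho_star xs; rewrite (le_trans xs) //.
  by rewrite (le_trans _ (ltW tM)) // le_max lexx.
have [K HK] := @eventually_geometric_le R C (M + e / 2) (M + e)
  ltac:(lra) ltac:(lra).
exists K.+1 => // k /= Kk; have k0 : (0 < k)%N by apply: leq_trans Kk.
have le1 : M <= largest_norm_root k := max_le_largest_norm_root k0.
rewrite distrC ger0_norm ?subr_ge0 // lerBlDl.
apply/(largest_norm_root_le k0); first by lra.
by move=> w wk; apply: le_trans (NC w) _; rewrite wk HK // ltnW.
Qed.

(* Above any level t > rho(A_1), only finitely many words give a cycle value,
   since rho <= C t^L along the cycle words of length L. *)
Lemma rho_star_attained :
  largest_spectral_radius < rho_star A -> cycle_values A (rho_star A).
Proof.
move=> rA; apply: contrapT => notA.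
have A0 : spectral_radius (A ord0) <= largest_spectral_radius by exact: le_bigmax.
have r0 : 0 <= largest_spectral_radius by exact: bigmax_ge_id.
set S := rho_star A in rA notA *.
(* The norm bound applies at level [t]; the gap from [t] to [T] absorbs [C], so cycle words of
   length at least [K] have values at most [T < S]. *)
pose t := (largest_spectral_radius + S) / 2; pose T := (t + S) / 2.
have [tA0 t0 tT TS] : [/\ spectral_radius (A ord0) < t, 0 < t, t < T & T < S].
  by rewrite /T /t; split; lra.
have [C C0 NC] := uniq_word_norm_bound hN tA0.
have [K HK] := eventually_geometric_le C t0 tT.
pose f (u : {k : 'I_K & k.-tuple 'I_m.+1}) : R :=
  spectral_radius (word_prod A (tagged u)) `^ (size (tagged u))%:R^-1.
(* The base value [T] covers the long words, the finite type of [u] the words shorter than [K]. If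
   [S] is not attained, [b] is an upper bound strictly below the supremum [S]. *)
pose b := \big[Num.max/T]_(u | `[< cycle_values A (f u) >]) f u.
have bS : b < S.
  apply/bigmax_ltP; split=> // u /asboolP fu.
  rewrite lt_neqAle cycle_le_rho_star // andbT.
  by apply/eqP => E; apply: notA; rewrite -E.
suff : S <= b by rewrite leNgt bS.
have [A0'|/set0P cA0] := eqVneq (cycle_values A) set0.
  by move: rA; rewrite /S /rho_star A0' sup0 ltNge r0.
apply: ge_sup => // x xA; have [w [w0 w_uniq xE]] := (cycle_valuesP A hN x).1 xA.
have sw0 : (0 < size w)%N.
  by apply: leq_trans w0 _; rewrite size_filter count_size.
have [wK|Kw] := ltnP (size w) K.
  pose u : {k : 'I_K & k.-tuple 'I_m.+1} :=
    Tagged (fun k : 'I_K => k.-tuple 'I_m.+1) (in_tuple w : (Ordinal wK).-tuple _).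
  have fu : f u = x by rewrite xE.
  by rewrite -fu; apply: le_bigmax_cond; apply/asboolP; rewrite fu.
apply: (@le_trans _ _ T); last exact: bigmax_ge_id.
rewrite xE root_le ?spectral_radius_ge0 //; last by lra.
apply: le_trans (spectral_radius_le_norm hN _) _.
by apply: le_trans (NC w w_uniq) _; exact: HK.
Qed.

End JointSpectralRadius.

(** As [rho_star] is a supremum, the second conjunct is what makes the right-hand side a true
    maximum over cycles and single matrices. *)
Theorem mainTheorem4 (R : realType) (n m : nat) (hn : (0 < n)%N)
    (N : 'M[R[i]]_n -> R) (hN : submultiplicative_norm N)
    (A : 'I_m.+1 -> 'M[R[i]]_n)
    (hirr : irreducible_family A)
    (hrank : forall j : 'I_m.+1, j != ord0 -> \rank (A j) = 1%N) :
  joint_spectral_radius N A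
    = Num.max (rho_star A) (\big[Num.max/0]_(i < m.+1) spectral_radius (A i))
  /\ (cycle_values A (joint_spectral_radius N A)
      \/ exists i : 'I_m.+1, joint_spectral_radius N A = spectral_radius (A i)).
Proof.
case: n hn N hN A hirr hrank => // n _ N hN A _ hrank.
have jsrE := joint_spectral_radius_rank1 hN hrank; split=> //; rewrite jsrE.
have [le_mx|lt_mx] := leP (rho_star A) (largest_spectral_radius A).
  right; have [|i _ iE] := @eq_bigmax _ _ _ 0 ord0 xpredT
    (fun i => spectral_radius (A i)) isT.
    by move=> i _; exact: spectral_radius_ge0.
  by exists i; exact: iE.
by left; exact: (rho_star_attained hN lt_mx).
Qed.
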